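(* Let $1<p<\infty$ and let $I$ be an uncountable index set. Then $L^{p,\infty}(\{-1,1\}^I)$ is not isomorphic to a subspace of $L^{p,\infty}(\Omega,\Sigma,\mu)$ for any purely atomic measure space $(\Omega,\Sigma,\mu)$.
   Context: $\{-1,1\}$ denotes the two-point probability space with each point of mass $\frac12$, and $\{-1,1\}^I$ the product probability space of $I$ copies of it. For a measure space $(\Omega,\Sigma,\mu)$, $L^{p,\infty}(\Omega,\Sigma,\mu)$ is the space of (equivalence classes of) measurable $f$ with $\|f\|=\sup_{c>0}c\,(\mu\{|f|>c\})^{1/p}<\infty$, a Banach space under an equivalent norm; isomorphism means linear homeomorphism. An atom is a measurable set $\sigma$ with $\mu(\sigma)>0$ such that each measurable $\sigma'\subseteq\sigma$ has $\mu(\sigma')=0$ or $\mu(\sigma\setminus\sigma')=0$. The space is purely atomic if $\Sigma$ is the smallest $\sigma$-algebra containing all atoms and all $\mu$-null sets. Measure spaces are assumed to contain a set of finite non-zero measure. *)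

(* Defs.v *)
From HB Require Import structures.
From mathcomp Require Import all_boot all_order all_algebra.
From mathcomp Require Import all_classical all_reals all_analysis.
Set Implicit Arguments. Unset Strict Implicit. Unset Printing Implicit Defensive.
Import Order.TTheory GRing.Theory Num.Theory.
Import numFieldNormedType.Exports.
Local Open Scope classical_set_scope.
Local Open Scope ring_scope.

(* Cylinder set of the cube {-1,1}^I (we encode -1,1 by false,true):
   all points agreeing with e on the finite set of coordinates s. *)
Definition cylinder (I : choiceType) (s : seq I) (e : I -> bool) : set (I -> bool) :=
  [set w | forall i, i \in s -> w i = e i].

Definition cylinders (I : choiceType) : set (set (I -> bool)) :=
  [set A | exists s e, A = cylinder s e].

Definition cube (I : choiceType) := g_sigma_algebraType (@cylinders I).

(* P is the product probability of I copies of the uniform measure on two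
   points: every cylinder on n distinct coordinates has measure 2^-n.
   (Such a measure exists and is unique on the product sigma-algebra.) *)
Definition coin_product (R : realType) (I : choiceType)
  (P : {measure set (cube I) -> \bar R}) : Prop :=
  forall (s : seq I) (e : I -> bool), uniq s ->
    P (cylinder s e : set (cube I)) = ((2 ^- size s : R)%:E)%E.

Definition weakLp_norm (R : realType) d (T : measurableType d)
  (mu : {measure set T -> \bar R}) (p : R) (f : T -> R) : \bar R :=
  ereal_sup [set (c%:E * poweR (mu [set x | (c < `|f x|)%R]) p^-1)%E
            | c in [set c : R | 0 < c]].

Definition weakLp (R : realType) d (T : measurableType d)
  (mu : {measure set T -> \bar R}) (p : R) (f : T -> R) : Prop :=
  measurable_fun setT f /\ (weakLp_norm mu p f < +oo)%E.

Definition atom (R : realType) d (T : measurableType d)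
  (mu : {measure set T -> \bar R}) (A : set T) : Prop :=
  [/\ measurable A, (0 < mu A)%E &
     forall B, measurable B -> B `<=` A -> mu B = 0%E \/ mu (A `\` B) = 0%E].

Definition purely_atomic (R : realType) d (T : measurableType d)
  (mu : {measure set T -> \bar R}) : Prop :=
  (measurable : set (set T)) =
  <<s [set A | atom mu A] `|` [set N | measurable N /\ mu N = 0%E] >>.

(* L^{p,infty}(P) is isomorphic (linear homeomorphism onto its image) to a
   subspace of L^{p,infty}(mu). Elements are a.e.-classes; we represent the
   map on representatives: it is linear up to a.e. equality and bounded above
   and below (for linear maps between quasi-normed spaces, this is exactly
   being an isomorphism onto the image; well-definedness on classes and
   injectivity follow from the bounds). *)
Definition weakLp_embeds (R : realType) d1 (T1 : measurableType d1)
  (P : {measure set T1 -> \bar R}) d2 (T2 : measurableType d2)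
  (mu : {measure set T2 -> \bar R}) (p : R) : Prop :=
  exists (L : (T1 -> R) -> (T2 -> R)) (c C : R),
  [/\ 0 < c, 0 < C,
      (forall f, weakLp P p f -> weakLp mu p (L f)),
      (forall f g (a b : R), weakLp P p f -> weakLp P p g ->
         {ae mu, forall x, L (fun y => a * f y + b * g y) x = a * L f x + b * L g x}) &
      (forall f, weakLp P p f ->
         (c%:E * weakLp_norm P p f <= weakLp_norm mu p (L f))%E /\
         (weakLp_norm mu p (L f) <= C%:E * weakLp_norm P p f)%E)].

(* Main.v *)
Require Import Defs.
From HB Require Import structures.
From mathcomp Require Import all_boot all_order all_algebra.
From mathcomp Require Import all_classical all_reals all_analysis.
From mathcomp Require Import measurable_realfun ring lra.
Import Order.TTheory GRing.Theory Num.Theory.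
Set Implicit Arguments. Unset Strict Implicit. Unset Printing Implicit Defensive.
Import numFieldNormedType.Exports.
Local Open Scope classical_set_scope.
Local Open Scope ring_scope.

(* Pick disjoint cylinders A_n of measure 2^-(n+1), let v_n^p = 2^(n+1), and let u_{n,i}
   be the image under the embedding of v_n 1_{A_n} eps_i, where eps_i is a coordinate not
   used by the A_n.  On a purely atomic space every set of finite measure is covered by
   countably many atoms, and on each atom only countably many u_{n,i} are nonzero, because
   sums of N coordinates have norm o(N).  Hence in every uncountable set of indices there
   is a sequence along which all the u_{n,i} have disjoint supports.
   If p > 2, the image of eps_1 + ... + eps_N (on A_0) has norm O(N^(1/p)) by
   disjointness, while its own norm is of order N^(1/2).
   If p <= 2, pass to uncountably many i for which, for every n < M, the set
   {|u_{n,i}| > l_n} has measure at least delta / l_n^p at the same level l_n.  With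
   rho <= l_n and N_n about (l_n/rho)^p, consider
     F = sum_{n < M} (rho/l_n) sum_{k < N_n} v_n 1_{A_n} eps_{n,k}.
   Since N_n (rho/l_n)^2 <= 1, fourth moments bound the norm of F independently of M;
   but its image exceeds rho on a set of measure at least M delta / (2 rho^p). *)

(** * Moments and tails of the simple random walk *)

Section walk.
Context {R : realType}.
Implicit Types (g h : R -> R) (x c : R) (N : nat).

(** The expectation of [g] at the position after [N] fair unit steps from [x]. As a recursion it
    gives moments by induction, with no integration. *)
Fixpoint walk_mean N g x : R :=
  if N is N'.+1 then (walk_mean N' g (x + 1) + walk_mean N' g (x - 1)) / 2
  else g x.

Lemma le_walk_mean N g h x : (forall y, g y <= h y) ->
  walk_mean N g x <= walk_mean N h x.
Proof.
move=> gh; elim: N x => [|N IH] x //=.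
by rewrite ler_pM2r ?invr_gt0// lerD.
Qed.

Lemma walk_mean_lin N g h (a b : R) x :
  walk_mean N (fun y => a * g y + b * h y) x =
  a * walk_mean N g x + b * walk_mean N h x.
Proof. by elim: N x => [|N IH] x //=; rewrite !IH; field. Qed.

Lemma walk_mean_cst N c x : walk_mean N (fun=> c) x = c.
Proof. by elim: N x => [|N IH] x //=; rewrite !IH; field. Qed.

Lemma walk_mean_sqr N x : walk_mean N (fun y => y ^+ 2) x = x ^+ 2 + N%:R.
Proof.
by elim: N x => [|N IH] x /=; rewrite ?addr0// !IH -natr1; field.
Qed.

Lemma walk_mean_pow4 N x : walk_mean N (fun y => y ^+ 4) x =
  x ^+ 4 + 6 * N%:R * x ^+ 2 + 3 * N%:R ^+ 2 - 2 * N%:R.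
Proof.
elim: N x => [|N IH] x /=; first by rewrite expr0n/= !mulr0 !mul0r; lra.
by rewrite !IH -natr1; field.
Qed.

Definition walk_tail N c := walk_mean N \1_[set y : R | c < `|y|] 0.

Lemma indic_le (T : Type) (A : set T) y (b : R) :
  0 <= b -> (A y -> 1 <= b) -> \1_A y <= b.
Proof.
by move=> b0 Ab; rewrite indicE; case: (boolP (y \in A)) => // /set_mem /Ab.
Qed.

Lemma walk_tail_le1 N c : walk_tail N c <= 1.
Proof.
rewrite -(walk_mean_cst N 1 0).
by apply: le_walk_mean => y; apply: indic_le.
Qed.

(** Chebyshev: the indicator is at most [y ^+ 2 / c ^+ 2]. *)
Lemma walk_tail_le2 N c : 0 < c -> walk_tail N c <= N%:R / c ^+ 2.
Proof.
move=> c0.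
(* The zero summand gives the integrand the two-term form of [walk_mean_lin]. *)
have -> : N%:R / c ^+ 2 =
    walk_mean N (fun y => (c ^+ 2)^-1 * y ^+ 2 + 0 * y ^+ 2) 0.
  by rewrite walk_mean_lin walk_mean_sqr mul0r expr0n/= add0r addr0 mulrC.
apply: le_walk_mean => y; rewrite mul0r addr0.
apply: indic_le; first by rewrite mulr_ge0// ?invr_ge0 ?sqr_ge0.
rewrite /= => cy; rewrite mulrC ler_pdivlMr ?exprn_gt0// mul1r.
by rewrite -[leRHS]real_normK ?num_real// lerXn2r ?nnegrE// ltW.
Qed.

(** Markov's inequality for the fourth moment, which is at most [3 * N ^+ 2]. Its faster decay in
    [c] keeps the sum over the blocks bounded even when [p = 2]. *)
Lemma walk_tail_le4 N c : 0 < c -> walk_tail N c <= 3 * N%:R ^+ 2 / c ^+ 4.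
Proof.
move=> c0.
apply: (@le_trans _ _ (walk_mean N (fun y => (c ^+ 4)^-1 * y ^+ 4 + 0 * y ^+ 2) 0)).
  apply: le_walk_mean => y; rewrite mul0r addr0.
  apply: indic_le.
    by rewrite mulr_ge0 ?invr_ge0 ?exprn_even_ge0.
  rewrite /= => cy; rewrite mulrC ler_pdivlMr ?exprn_gt0// mul1r.
  rewrite -[y ^+ 4]/(y ^+ (2 * 2)) exprM -[y ^+ 2]real_normK ?num_real// -exprM.
  by rewrite lerXn2r ?nnegrE// ltW.
rewrite walk_mean_lin walk_mean_pow4 mul0r addr0 mulrC ler_pM2r ?invr_gt0 ?exprn_gt0//.
rewrite expr0n/= expr0n/= mulr0 !add0r gerDl oppr_le0 mulr_ge0//.
Qed.

(* Paley-Zygmund: take the mean of a pointwise inequality between [y ^+ 2], [y ^+ 4] and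
   the indicator. *)
Lemma walk_tail_ge N : (0 < N)%N -> 6^-1 <= walk_tail N (Num.sqrt N%:R / 2).
Proof.
move=> N0; have n0 : 0 < N%:R :> R by rewrite ltr0n.
set c := _ / 2; have c2 : c ^+ 2 = N%:R / 4.
  by rewrite /c expr_div_n sqr_sqrtr ?ler0n// -natrX.
have c0 : 0 <= c by rewrite divr_ge0// sqrtr_ge0.
(* Off the tail, [y ^+ 2 <= N / 4]. On it, the left side is a parabola in [y ^+ 2] with maximum
   [3 / 2 * N], attained at [y ^+ 2 = 3 * N]. *)
have key : walk_mean N (fun y => 1 * y ^+ 2 + (- (6 * N%:R)^-1) * y ^+ 4) 0 <=
  walk_mean N (fun y => 1 * (N%:R / 4) + (3 / 2 * N%:R) * \1_[set y : R | c < `|y|] y) 0.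
  apply: le_walk_mean => y; rewrite !mul1r indicE.
  case: (boolP (y \in _)) => [_|/negP]; last first.
    rewrite inE /= => /negP; rewrite -leNgt => yc.
    have : y ^+ 2 <= c ^+ 2 by rewrite -[leLHS]real_normK ?num_real// lerXn2r ?nnegrE.
    rewrite c2 => y2; rewrite mulr0 addr0 (le_trans _ y2)// gerDl mulNr oppr_le0.
    by rewrite mulr_ge0 ?exprn_even_ge0// invr_ge0 mulr_ge0.
  rewrite mulr1.
  have -> : y ^+ 2 + - (6 * N%:R)^-1 * y ^+ 4 =
      3 / 2 * N%:R - (6 * N%:R)^-1 * (y ^+ 2 - 3 * N%:R) ^+ 2.
    by field; rewrite lt0r_neq0.
  apply: (@le_trans _ _ (3 / 2 * N%:R)); last by lra.
  by rewrite gerDl oppr_le0 mulr_ge0 ?sqr_ge0// invr_ge0 mulr_ge0.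
move: key; rewrite !walk_mean_lin walk_mean_cst walk_mean_sqr walk_mean_pow4.
rewrite -/(walk_tail N c) expr0n/= expr0n/= mulr0 !add0r.
have -> : - (6 * N%:R)^-1 * (3 * N%:R ^+ 2 - 2 * N%:R) = 3^-1 - N%:R / 2 :> R.
  by field; rewrite lt0r_neq0.
rewrite !mul1r => key.
suff : N%:R * 6^-1 <= N%:R * walk_tail N c by rewrite ler_pM2l.
by nra.
Qed.

End walk.

(** * Uniform tail bounds and a geometric sum *)

Section walk_tail_bounds.
Context {R : realType}.

(** In [N] steps the walk moves a distance of at most [N]. *)
Lemma walk_mean_eq0 N (g : R -> R) x :
  (forall y, `|y - x| <= N%:R -> g y = 0) -> walk_mean N g x = 0.
Proof.
elim: N x => [|N IH] x g0 /=; first by apply: g0; rewrite subrr normr0.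
rewrite !IH ?addr0 ?mul0r// => y yx; apply: g0; rewrite -natr1.
  rewrite (_ : y - x = (y - (x - 1)) - 1); last by ring.
  by rewrite (le_trans (ler_normB _ _))// normr1 lerD2r.
rewrite (_ : y - x = (y - (x + 1)) + 1); last by ring.
by rewrite (le_trans (ler_normD _ _))// normr1 lerD2r.
Qed.

(** A sum of [N] signs has weak norm o(N). Let [h ^ p = k]. For [c <= h * N] the right side is at
    least 1; for [c >= N] the tail vanishes; in between, Chebyshev gives at most [1 / (h ^ 2 * N)],
    which is below [k] for large [N]. *)
Lemma walk_tail_small (p k : R) : 0 < p -> 0 < k -> exists N0 : nat, (0 < N0)%N /\
  forall N (c : R), (N0 <= N)%N -> 0 < c -> walk_tail N c <= k * (N%:R / c) `^ p.
Proof.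
move=> p0 k0; pose h := k `^ p^-1.
have h0 : 0 < h by rewrite powR_gt0.
have hp : h `^ p = k by rewrite /h -powRrM mulVf ?lt0r_neq0// powRr1 ?ltW.
have p1 : 1 `^ p = 1 :> R by rewrite powR1.
exists (Num.truncn ((h ^+ 2 * k)^-1)).+1; split=> // N c N1 c0.
have N0 : 0 < N%:R :> R by rewrite ltr0n (leq_trans _ N1).
have Nc0 : 0 <= N%:R / c by rewrite divr_ge0 ?ler0n ?ltW.
have [cN|Nc] := leP (h^-1) (N%:R / c).
  apply: (le_trans (walk_tail_le1 _ _)).
  rewrite -hp -powRM ?(ltW h0)//.
  rewrite -[leLHS]p1; apply: ge0_ler_powR; rewrite ?nnegrE ?(ltW p0)// ?(mulr_ge0 (ltW h0) Nc0)//.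
  by rewrite mulrC -ler_pdivrMr// div1r.
have [cN|cN] := leP N%:R c.
  rewrite /walk_tail walk_mean_eq0 ?mulr_ge0 ?powR_ge0 ?ltW// => y; rewrite subr0 => yN.
  by rewrite indicE memNset//= ltNge (le_trans yN).
apply: (le_trans (walk_tail_le2 N c0)).
apply: (@le_trans _ _ k); last first.
  rewrite -{1}(mulr1 k) ler_pM2l// -[leLHS]p1.
  apply: ge0_ler_powR; rewrite ?nnegrE ?(ltW p0)//.
  by rewrite ler_pdivlMr// mul1r ltW.
have -> : N%:R / c ^+ 2 = (N%:R / c) ^+ 2 / N%:R by field; rewrite !lt0r_neq0.
rewrite ler_pdivrMr// (@le_trans _ _ (h^-1 ^+ 2))//.
  by rewrite lerXn2r ?nnegrE ?invr_ge0 ?(ltW h0)// ltW.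
have : (h ^+ 2 * k)^-1 < N%:R by apply: (lt_le_trans (truncnS_gt _)); rewrite ler_nat.
rewrite -(ltr_pM2l k0) => /ltW/(le_trans _); apply.
by rewrite le_eqVlt; apply/orP; left; apply/eqP; field; rewrite !lt0r_neq0.
Qed.

(** The terms double while below 1 and halve afterwards. The two-branch bound is an invariant for
    the induction, which replaces [z] by [2 * z]. *)
Lemma sum_min_geometric M (z : R) : 0 < z ->
  \sum_(0 <= n < M) Num.min (z * 2 ^+ n) (z * 2 ^+ n)^-1 <=
  if 1 <= z then 2 / z else 4 - 2 * z.
Proof.
elim: M z => [|M IH] z z0.
  rewrite big_nil; case: ifPn => [_|]; first by rewrite divr_ge0 ?ltW.
  by rewrite -ltNge => z1; lra.
rewrite big_nat_recl// expr0 mulr1.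
under eq_bigr do rewrite exprS mulrA.
have z20 : 0 < z * 2 by rewrite mulr_gt0.
have {IH} := IH _ z20; set S := bigop _ _ _.
have minl : Num.min z z^-1 <= z by rewrite ge_min lexx.
have minr : Num.min z z^-1 <= z^-1 by rewrite ge_min lexx orbT.
have zv : z * z^-1 = 1 by rewrite mulfV ?lt0r_neq0.
have -> : 2 / (z * 2) = z^-1 by field; rewrite lt0r_neq0.
(* Only [1 / 2 <= z < 1] is left after [lra]: there the bound changes branch between [z] and
   [2 * z]. *)
case: (lerP 1 (z * 2)) => h2 SS; case: (lerP 1 z) => h1; try lra.
  apply: (@le_trans _ _ (z + z^-1)); first exact: lerD.
  rewrite -subr_ge0.
  have -> : 4 - 2 * z - (z + z^-1) = (1 - z) * (3 * z - 1) / z by field; rewrite lt0r_neq0.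
  by rewrite divr_ge0 ?(ltW z0)// mulr_ge0; lra.
Qed.

Lemma sum_min_geometric_le4 M (z : R) : 0 < z ->
  \sum_(0 <= n < M) Num.min (z * 2 ^+ n) (z * 2 ^+ n)^-1 <= 4.
Proof.
move=> z0; apply: (le_trans (sum_min_geometric M z0)).
by case: (lerP 1 z) => z1; [rewrite ler_pdivrMr|]; lra.
Qed.
End walk_tail_bounds.

(** * Weak-type estimates *)

Lemma powR_inv (R : realType) (a p : R) : 0 <= a -> a^-1 `^ p = (a `^ p)^-1.
Proof. by move=> a0; rewrite -powR_inv1// -powRrM mulN1r powRN. Qed.

Section weak_tail.
Context {R : realType} d {T : measurableType d}.
Variables (mu : {measure set T -> \bar R}) (p : R).
Hypothesis p0 : 0 < p.
Implicit Types (f g : T -> R) (a c K : R).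

(** For [0 <= a], a bound by [a] on the [p]-th power of the weak norm. In this form bounds add up
    over disjoint supports. *)
Definition weak_tail f a := forall c, 0 < c ->
  (mu [set x | (c < `|f x|)%R] <= (a / c `^ p)%:E)%E.

Lemma weakLp_norm_leP f K : 0 <= K ->
  (weakLp_norm mu p f <= K%:E)%E <-> weak_tail f (K `^ p).
Proof.
move=> K0; split=> [normf c c0|tailf].
  have {normf} : (c%:E * poweR (mu [set x | (c < `|f x|)%R]) p^-1 <= K%:E)%E.
    by apply: le_trans normf; apply: ereal_sup_ubound; exists c.
  have : (0 <= mu [set x | (c < `|f x|)%R])%E by [].
  case: (mu _) => [r| |] //; last first.
    by rewrite poweRyr ?invr_neq0 ?lt0r_neq0// gt0_muley ?lte_fin.
  rewrite poweR_EFin -EFinM !lee_fin => r0 cr.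
  have -> : r = (r `^ p^-1) `^ p by rewrite -powRrM mulVf ?lt0r_neq0// powRr1.
  have -> : K `^ p / c `^ p = (K / c) `^ p.
    by rewrite powRM ?invr_ge0 ?(ltW c0)// powR_inv// ltW.
  apply: ge0_ler_powR; rewrite ?nnegrE ?powR_ge0 ?divr_ge0 ?(ltW p0) ?(ltW c0)//.
  by rewrite ler_pdivlMr// mulrC.
apply: ge_ereal_sup => _ [c /= c0 <-].
have := tailf c c0.
have : (0 <= mu [set x | (c < `|f x|)%R])%E by [].
case: (mu _) => [r| |] //.
rewrite poweR_EFin -EFinM !lee_fin => r0; rewrite ler_pdivlMr ?powR_gt0// => rc.
have -> : K = (K `^ p) `^ p^-1 by rewrite -powRrM mulfV ?lt0r_neq0// powRr1.
have -> : c = (c `^ p) `^ p^-1 by rewrite -powRrM mulfV ?lt0r_neq0// powRr1 ?ltW.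
rewrite -powRM ?powR_ge0//.
apply: ge0_ler_powR; rewrite ?nnegrE ?powR_ge0 ?invr_ge0 ?(ltW p0)//.
  by rewrite mulr_ge0 ?powR_ge0.
by rewrite mulrC.
Qed.

Lemma weak_tail_weakLp f a : measurable_fun setT f -> 0 <= a ->
  weak_tail f a -> weakLp mu p f.
Proof.
move=> mf a0 tf; split=> //; apply: (@le_lt_trans _ _ (a `^ p^-1)%:E); last exact: ltry.
by apply/weakLp_norm_leP; rewrite ?powR_ge0// -powRrM mulVf ?lt0r_neq0// powRr1.
Qed.

End weak_tail.

(** The norm bounds of the embedding, raised to the power [p]; the larger of [C ^ p] and [c ^ (- p)]
    serves in both directions. *)
Lemma weakLp_embeds_tail (R : realType) d1 (T1 : measurableType d1)
  (P : {measure set T1 -> \bar R}) d2 (T2 : measurableType d2)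
  (mu : {measure set T2 -> \bar R}) (p : R) : 0 < p -> weakLp_embeds P mu p ->
  exists (L : (T1 -> R) -> (T2 -> R)) (D : R), [/\ 0 < D,
    forall f, weakLp P p f -> measurable_fun setT (L f),
    forall f g (a b : R), weakLp P p f -> weakLp P p g ->
         {ae mu, forall x, L (fun y => a * f y + b * g y) x = a * L f x + b * L g x},
    forall f a, weakLp P p f -> 0 <= a ->
      weak_tail P p f a -> weak_tail mu p (L f) (D * a) &
    forall f a, weakLp P p f -> 0 <= a ->
      weak_tail mu p (L f) a -> weak_tail P p f (D * a)].
Proof.
move=> p0 [L [c [C [c0 C0 Lw Llin Lb]]]].
have ppK a : 0 <= a -> (a `^ p^-1) `^ p = a.
  by move=> a0; rewrite -powRrM mulVf ?lt0r_neq0// powRr1.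
exists L, (Num.max (C `^ p) (c^-1 `^ p)).
have wt d (T : measurableType d) (m : {measure set T -> \bar R}) (f : T -> R) a b :
    a <= b -> weak_tail m p f a -> weak_tail m p f b.
  move=> ab tf t t0; apply: (le_trans (tf t t0)).
  by rewrite lee_fin ler_wpM2r// invr_ge0 powR_ge0.
split=> //.
- by rewrite lt_max powR_gt0.
- by move=> f /Lw[].
- move=> f a fw a0 tf; have [_ Lf] := Lb f fw.
  apply: (@wt _ _ _ _ (C `^ p * a)); first by rewrite ler_wpM2r// le_max lexx.
  rewrite -{1}(ppK a a0) -powRM ?powR_ge0// ?(ltW C0)//.
  apply/weakLp_norm_leP; rewrite ?mulr_ge0 ?powR_ge0 ?(ltW C0)//.
  apply: (le_trans Lf); rewrite EFinM lee_pmul2l ?lte_fin//.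
  by apply/weakLp_norm_leP; rewrite ?powR_ge0// ppK.
- move=> f a fw a0 tf; have [Lf _] := Lb f fw.
  apply: (@wt _ _ _ _ (c^-1 `^ p * a)).
    by rewrite ler_wpM2r// le_max lexx orbT.
  rewrite -{1}(ppK a a0) -powRM ?powR_ge0// ?invr_ge0 ?(ltW c0)//.
  apply/weakLp_norm_leP; rewrite ?mulr_ge0 ?powR_ge0 ?invr_ge0 ?(ltW c0)//.
  rewrite -(@lee_pmul2l _ c%:E) ?lte_fin//; apply: (le_trans Lf).
  rewrite -EFinM mulrA mulfV ?lt0r_neq0// mul1r.
  by apply/weakLp_norm_leP; rewrite ?powR_ge0// ppK.
Qed.

(** * Comparison almost everywhere and sums with disjoint supports *)

Section almost_everywhere.
Context {R : realType} d {T : measurableType d}.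
Variable mu : {measure set T -> \bar R}.
Implicit Types (A B E : set T).

Lemma ae_imply_of_null A B : measurable A -> measurable B -> mu (A `\` B) = 0%E ->
  {ae mu, forall x, A x -> B x}.
Proof.
move=> mA mB AB; exists (A `\` B); split => //; first exact: measurableD.
by move=> x /= /not_implyP[].
Qed.

Lemma le_measure_ae A B : measurable A -> measurable B ->
  {ae mu, forall x, A x -> B x} -> (mu A <= mu B)%E.
Proof.
move=> mA mB [N [mN N0 AB]].
apply: (@le_trans _ _ (mu (B `|` N))).
  rewrite le_measure ?inE//; first exact: measurableU.
  move=> x Ax; have [Bx|nBx] := pselect (B x); [by left|right; apply: AB].
  by move=> /(_ Ax).
by rewrite measureU0.
Qed.

Lemma eq_measure_ae A B : measurable A -> measurable B ->
  {ae mu, forall x, A x <-> B x} -> mu A = mu B.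
Proof.
move=> mA mB AB; apply/eqP; rewrite eq_le; apply/andP; split;
  by apply: le_measure_ae => //; apply: filterS AB => x [].
Qed.

Lemma ae_seq (K : eqType) (r : seq K) (Q : K -> T -> Prop) :
  (forall k, k \in r -> {ae mu, forall x, Q k x}) ->
  {ae mu, forall x k, k \in r -> Q k x}.
Proof.
elim: r => [|k r IH] Qr; first by apply: aeW.
have := IH (fun j jr => Qr j (mem_behead (s := k :: r) jr)).
apply: filterS2 (Qr k (mem_head _ _)) => x Qk Qs j.
by rewrite inE => /predU1P[->|/Qs].
Qed.

Lemma measurable_gt_abs (f : T -> R) c : measurable_fun setT f ->
  measurable [set x | c < `|f x|].
Proof.
move=> mf; rewrite -[X in measurable X]setTI.
have -> : [set x | c < `|f x|] = (Num.norm \o f) @^-1` `]c, +oo[.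
  by apply/seteqP; split=> x /=; rewrite in_itv/= andbT.
exact: (measurableT_comp (@normr_measurable _ setT) mf).
Qed.

Lemma measurable_neq0 (f : T -> R) : measurable_fun setT f ->
  measurable [set x | f x != 0].
Proof.
move=> mf; have -> : [set x | f x != 0] = [set x | 0 < `|f x|].
  by apply/seteqP; split=> x /=; rewrite normr_gt0.
exact: measurable_gt_abs.
Qed.

(** Almost every point lies in at most one support, so up to a null set the level set of the sum is
    the disjoint union of those of the summands. *)
Lemma measure_gt_abs_sum (K : eqType) (r : seq K) (f : K -> T -> R) c :
  0 < c -> uniq r -> (forall k, measurable_fun setT (f k)) ->
  (forall k l, k != l -> mu ([set x | f k x != 0] `&` [set x | f l x != 0]) = 0%E) ->
  mu [set x | (c < `|(\sum_(k <- r) f k x)%R|)%R] =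
  (\sum_(k <- r) mu [set x | (c < `|f k x|)%R])%E.
Proof.
move=> c0 + mf disj; elim: r => [_|k r IH /= /andP[kr ur]].
  rewrite big_nil -[RHS](measure0 mu); congr (mu _).
  by apply/seteqP; split=> // x; rewrite /= big_nil normr0 ltNge (ltW c0).
rewrite big_cons -IH//.
set A := [set x | c < `|f k x|]; set B := [set x | c < `|\sum_(k <- r) f k x|].
have mS : measurable_fun setT (fun x => \sum_(k <- r) f k x) by exact: measurable_sum.
have mA : measurable A by exact: measurable_gt_abs.
have mB : measurable B by exact: measurable_gt_abs.
have ae0 : {ae mu, forall x, forall l, l \in r -> f k x != 0 -> f l x = 0}.
  apply: ae_seq => l lr; exists ([set x | f k x != 0] `&` [set x | f l x != 0]); split.
  - by apply: measurableI; exact: measurable_neq0.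
  - by apply: disj; apply: contraNneq kr => ->.
  - by move=> x /= /not_implyP[? /eqP].
have sum0 x : (forall l, l \in r -> f k x != 0 -> f l x = 0) -> f k x != 0 ->
    \sum_(l <- r) f l x = 0.
  by move=> H fk0; rewrite big_seq big1// => l lr; exact: H.
transitivity (mu (A `|` (B `\` A))).
  apply: eq_measure_ae => //.
  - by apply: measurable_gt_abs; exact: measurable_sum.
  - by apply: measurableU => //; exact: measurableD.
  - apply: filterS ae0 => x /sum0 H /=; rewrite big_cons /A /B /=.
    have [fk0|/H ->] := eqVneq (f k x) 0.
      rewrite fk0 add0r normr0 (_ : (c < 0) = false); last by rewrite ltNge (ltW c0).
      by split=> [?|[]//[]//]; right; split.
    rewrite addr0 normr0 (_ : (c < 0) = false); last by rewrite ltNge (ltW c0).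
    by split=> [?|[]//[]//]; left.
rewrite measureU//.
- congr (_ + _)%E; apply: eq_measure_ae => //; first exact: measurableD.
  apply: filterS ae0 => x /sum0 H; rewrite /A /B /=.
  have [fk0|/H ->] := eqVneq (f k x) 0.
    by rewrite fk0 normr0 [c < 0]ltNge (ltW c0)/=; split=> [[]//|?]; split.
  by rewrite normr0 [c < 0]ltNge (ltW c0)/=; split=> [[]//|].
- exact: measurableD.
- by apply/seteqP; split=> // x [? []].
Qed.

End almost_everywhere.

(** Greedy choice: the finitely many earlier terms exclude only countably many elements of the
    uncountable set [Z]. *)
Lemma free_sequence (I : choiceType) (Z : set I) (C : I -> set I) :
  ~ countable Z -> (forall i, Z i -> countable (C i `&` Z)) ->
  exists x : nat -> I, (forall n, Z (x n)) /\
    forall m n, (m < n)%N -> ~ C (x m) (x n).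
Proof.
move=> Zunc Ccnt.
have [i0 _] : exists i, Z i.
  by apply: contrapT => /forallNP nZ; apply: Zunc; rewrite (_ : Z = set0)// -subset0.
have /choice[g gP] (s : seq I) : exists j, (forall i, i \in s -> Z i) ->
    Z j /\ forall i, i \in s -> ~ C i j.
  have [sZ|?] := pselect (forall i, i \in s -> Z i); last first.
    by exists i0.
  apply: contrapT => H; apply: Zunc.
  apply: (@sub_countable _ _ _ (\bigcup_(i in [set` s]) (C i `&` Z))); last first.
    apply: bigcup_countable; first exact/finite_set_countable/finite_seq.
    by move=> i /= /sZ /Ccnt.
  apply: subset_card_le => j Zj; apply: contrapT => nj; apply: H.
  by exists j => _; split=> // i si Cij; apply: nj; exists i.
(* [S n] lists the first [n] terms, latest first. *)
pose S := fix S n := if n is n'.+1 then g (S n') :: S n' else [::].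
have SZ n : forall i, i \in S n -> Z i.
  elim: n => // n IH i; rewrite inE => /predU1P[->|/IH//].
  by have [] := gP (S n) IH.
exists (fun n => g (S n)); split=> [n|m n mn]; first by have [] := gP _ (SZ n).
have [_] := gP _ (SZ n); apply.
elim: n mn => // n IH; rewrite ltnS leq_eqVlt => /predU1P[<-|/IH].
  exact: mem_head.
by move=> /= H; rewrite inE H orbT.
Qed.

(** * Coordinate sums on the cube *)

Section cube.
Context {R : realType} {I : choiceType}.
Implicit Types (s : seq I) (e : I -> bool) (w : cube I).

Definition coord_sum s w : R := \sum_(i <- s) (if w i then 1 else -1).

Lemma measurable_cylinder s e : measurable (cylinder s e : set (cube I)).
Proof. by apply: sub_sigma_algebra; exists s, e. Qed.

Lemma measurable_coord_sum s : measurable_fun setT (coord_sum s).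
Proof.
apply: measurable_sum => i.
have -> : (fun w : cube I => if w i then 1 else -1 : R) =
    (fun w => 2 * \1_(cylinder [:: i] (fun=> true) : set (cube I)) w - 1).
  apply/funext => w; rewrite indicE; case: ifPn => wi.
    by rewrite mem_set ?mulr1 1?[2]addrC ?addrK// => j; rewrite inE => /eqP ->.
  by rewrite memNset ?mulr0 ?sub0r// => /(_ i); rewrite mem_head (negbTE wi) => /(_ isT).
apply: measurable_funD => //; apply: measurable_funM => //.
by apply: measurable_indic; exact: measurable_cylinder.
Qed.

Lemma coord_sum_nil w : coord_sum [::] w = 0.
Proof. by rewrite /coord_sum big_nil. Qed.

Lemma coord_sum_cons i s w :
  coord_sum (i :: s) w = (if w i then 1 else -1) + coord_sum s w.
Proof. by rewrite /coord_sum big_cons. Qed.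

Lemma coord_sum_le s w : `|coord_sum s w| <= (size s)%:R.
Proof.
elim: s => [|i s IH]; first by rewrite /coord_sum big_nil normr0.
rewrite coord_sum_cons /= -natr1 addrC (le_trans (ler_normD _ _))// lerD//.
by case: ifP; rewrite ?normrN normr1.
Qed.

Variable P : {measure set (cube I) -> \bar R}.
Hypothesis coinP : coin_product P.

(** Given the coordinates in [s0], the sum over the fresh coordinates [s] is a random walk. The
    cylinder stays general because the induction on [s] moves coordinates into it. *)
Lemma coord_sum_law s0 e s (B : set R) x : measurable B -> uniq (s0 ++ s) ->
  P (cylinder s0 e `&` [set w | B (x + coord_sum s w)]) =
  (2 ^- size s0 * walk_mean (size s) \1_B x)%:E.
Proof.
move=> mB; elim: s s0 e x => [|i s IH] s0 e x /= us.
  rewrite cats0 in us; rewrite indicE.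
  case: (boolP (x \in B)) => [/set_mem|/negP] xB.
    rewrite mulr1 -(coinP e us) -[in RHS](setIT (cylinder s0 e)).
    congr (P (_ `&` _)); apply/seteqP; split=> // w _ /=.
    by rewrite coord_sum_nil addr0.
  rewrite mulr0 -[RHS](measure0 P) -[in RHS](setI0 (cylinder s0 e)).
  congr (P (_ `&` _)); apply/seteqP; split=> // w /=.
  by rewrite coord_sum_nil addr0 => /mem_set.
have us' : uniq ((i :: s0) ++ s) by move: us; rewrite -(cat1s i s) uniq_catCA.
have is0 : i \notin s0 by move: us' => /= /andP[]; rewrite mem_cat negb_or => /andP[].
pose e' b := fun j => if j == i then b else e j.
(* Fixing the coordinate [i] to [b] enlarges the cylinder and moves the start of the walk by one
   step. *)
pose A b : set (cube I) := cylinder (i :: s0) (e' b) `&`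
  [set w | B (x + (if b then 1 else -1) + coord_sum s w)].
have -> : cylinder s0 e `&` [set w | B (x + coord_sum (i :: s) w)] =
    A true `|` A false.
  apply/seteqP; split=> [w [we wB]|w].
    have [wi|wi] := boolP (w i); [left|right]; split => /=.
    - by move=> j; rewrite inE /e'; case: eqP => [->//|_] /= /we.
    - by move: wB; rewrite /= coord_sum_cons wi addrA.
    - by move=> j; rewrite inE /e'; case: eqP => [-> _|_ /= /we//]; exact/negbTE.
    - by move: wB; rewrite /= coord_sum_cons (negbTE wi) addrA.
  have cyl b : cylinder (i :: s0) (e' b) w -> cylinder s0 e w /\ w i = b.
    move=> we; split; last by rewrite we ?mem_head// /e' eqxx.
    move=> j js; rewrite we ?inE ?js ?orbT// /e'.
    by case: eqP js is0 => // -> ->.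
  by case=> -[/cyl[we wi] wB]; split=> //=; rewrite coord_sum_cons wi addrA.
have mA b : measurable (A b).
  apply: measurableI; first exact: measurable_cylinder.
  rewrite -[X in measurable X]setTI.
  apply: (_ : measurable_fun setT _) => //.
  by apply: measurable_funD => //; exact: measurable_coord_sum.
have PA b : P (A b) = (2 ^- (size s0).+1 *
    walk_mean (size s) \1_B (x + (if b then 1 else -1)))%:E by exact: IH.
have A0 : A true `&` A false = set0.
  apply/seteqP; split=> // w [[wt _] [wf _]] /=.
  by have := wt i (mem_head _ _); rewrite (wf i (mem_head _ _)) /e' eqxx.
transitivity (P (A true) + P (A false))%E; first exact: measureU.
rewrite !PA -EFinD /= exprS invfM; congr EFin; by field; rewrite expf_neq0.
Qed.

End cube.

(** * Normalized Rademacher sums on disjoint cylinders *)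

Section block_fun.
Context {R : realType} {I : choiceType}.
Variables (P : {measure set (cube I) -> \bar R}) (p : R) (J : nat -> I).
Hypotheses (coinP : coin_product P) (p0 : 0 < p) (injJ : injective J).
Implicit Types (s : seq I) (w : cube I) (m n : nat) (a c : R).

(** The event that, along [J], the first coordinate equal to [false] is [J n]. These events are
    disjoint and [block n] has probability [2 ^- n.+1]. *)
Definition block n : set (cube I) :=
  cylinder (mkseq J n.+1) (fun i => i \in mkseq J n).

(* The [p]-th power of [scale n] is the inverse of [P (block n)]. *)
Definition scale n : R := (2 ^+ n.+1) `^ p^-1.

Definition block_fun n s w : R := scale n * (\1_(block n) w * coord_sum s w).

(** The coordinates on which no block depends, hence independent of all blocks. *)
Definition free_coords : set I := ~` range J.

Lemma scale_gt0 n : 0 < scale n.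
Proof. by rewrite powR_gt0// exprn_gt0. Qed.

Lemma scaleK n : scale n `^ p = 2 ^+ n.+1.
Proof. by rewrite -powRrM mulVf ?lt0r_neq0// powRr1// exprn_ge0. Qed.

(** For [m < n] the two blocks prescribe different values at [J m]. *)
Lemma block_disjoint m n w : m != n -> block m w -> block n w -> False.
Proof.
wlog mn : m n / (m < n)%N.
  move=> H; case: (ltngtP m n) => [mn _ bm bn|nm _ bm bn|-> /eqP//].
    by apply: (H m n) => //; rewrite neq_ltn mn.
  by apply: (H n m) => //; rewrite neq_ltn nm.
move=> _ bm bn.
have Jin k l : (k < l)%N -> J k \in mkseq J l by move=> kl; rewrite map_f// mem_iota.
have := bm (J m) (Jin _ _ (ltnSn m)); rewrite (bn (J m) (Jin _ _ (leqW mn))).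
rewrite Jin// => /esym /mapP[k]; rewrite mem_iota add0n => /andP[_ km] /injJ mk.
by move: km; rewrite mk ltnn.
Qed.

Lemma measurable_block_fun n s : measurable_fun setT (block_fun n s).
Proof.
apply: measurable_funM => //; apply: measurable_funM.
  by apply: measurable_indic; exact: measurable_cylinder.
exact: measurable_coord_sum.
Qed.

Lemma block_fun_bounded n s w : `|block_fun n s w| <= scale n * (size s)%:R.
Proof.
rewrite normrM gtr0_norm ?scale_gt0// ler_pM2l ?scale_gt0//.
rewrite normrM (le_trans _ (coord_sum_le s w))// -[leRHS]mul1r.
by rewrite ler_wpM2r// indicE; case: (_ \in _); rewrite ?normr0 ?normr1.
Qed.

Lemma block_fun_seq n s w : block_fun n s w = \sum_(i <- s) block_fun n [:: i] w.
Proof.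
rewrite /block_fun -!mulr_sumr; congr (_ * (_ * _)).
by apply: eq_bigr => i _; rewrite /coord_sum big_seq1.
Qed.

Lemma block_fun_neq0 n s w : block_fun n s w != 0 -> block n w.
Proof.
rewrite /block_fun indicE; case: (boolP (w \in _)) => [/set_mem//|_].
by rewrite mul0r mulr0 eqxx.
Qed.

Lemma block_fun_law n s a c : 0 < a -> 0 < c -> uniq s -> [set` s] `<=` free_coords ->
  P [set w | c < `|a * block_fun n s w|] =
  (2 ^- n.+1 * walk_tail (size s) (c / (a * scale n)))%:E.
Proof.
move=> a0 c0 us sJ.
have sc0 := scale_gt0 n.
have us' : uniq (mkseq J n.+1 ++ s).
  rewrite cat_uniq mkseq_uniq//= us andbT; apply/hasPn => i /sJ nJ.
  by apply/negP => /mapP[k _ ik]; apply: nJ; exists k.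
pose B := [set y : R | c / (a * scale n) < `|y|].
have mB : measurable B by apply: (@measurable_gt_abs _ _ _ id).
have := coord_sum_law coinP (fun i => i \in mkseq J n) 0 mB us'.
rewrite size_mkseq => <-; congr (P _); apply/seteqP; split=> w.
  rewrite /= => cw.
  have bw : block n w.
    apply: (@block_fun_neq0 n s); apply/negP => /eqP w0.
    by move: cw; rewrite w0 mulr0 normr0 ltNge (ltW c0).
  split=> //=; move: cw; rewrite /B /= /block_fun indicE mem_set// mul1r add0r.
  by rewrite mulrA normrM gtr0_norm ?mulr_gt0// ltr_pdivrMr ?mulr_gt0// mulrC.
case=> bw; rewrite /B /= add0r ltr_pdivrMr ?mulr_gt0// mulrC => cw.
rewrite /block_fun indicE mem_set// mul1r mulrA normrM.
by rewrite gtr0_norm ?mulr_gt0.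
Qed.

Lemma coin_productT : P setT = 1%E.
Proof.
rewrite -[RHS]/((1 : R)%:E) -invr1 -[in RHS](expr0 2) -(coinP (s := [::]) xpredT)//.
by congr (P _); apply/seteqP; split.
Qed.

Lemma bounded_tail (f : cube I -> R) B : 0 <= B -> measurable_fun setT f ->
  (forall w, `|f w| <= B) -> weak_tail P p f (B `^ p).
Proof.
move=> B0 mf fB c c0.
have [Bc|cB] := leP B c.
  rewrite (_ : [set w | _] = set0) ?measure0 ?lee_fin ?divr_ge0 ?powR_ge0//.
  by apply/seteqP; split=> // w /=; rewrite ltNge (le_trans (fB w)).
apply: (@le_trans _ _ (P setT)).
  by rewrite le_measure ?inE//; exact: measurable_gt_abs.
rewrite coin_productT lee_fin ler_pdivlMr ?powR_gt0// mul1r.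
by apply: ge0_ler_powR; rewrite ?nnegrE ?(ltW p0) ?(ltW c0) ?(ltW cB).
Qed.

(** The o(N) bound for walks. [N0] is uniform in [n] because [scale n ^ p] cancels the probability
    of the block. *)
Lemma block_fun_tail_small k : 0 < k -> exists N0, (0 < N0)%N /\
  forall n s, (N0 <= size s)%N -> uniq s -> [set` s] `<=` free_coords ->
  weak_tail P p (block_fun n s) (k * (size s)%:R `^ p).
Proof.
move=> k0; have [N0 [N00 H]] := walk_tail_small p0 k0.
exists N0; split=> // n s Ns us sJ c c0.
have -> : [set w | c < `|block_fun n s w|] = [set w | c < `|1 * block_fun n s w|].
  by apply/seteqP; split=> w /=; rewrite mul1r.
rewrite block_fun_law// mul1r lee_fin.
have sc0 := scale_gt0 n.
apply: (@le_trans _ _ (2 ^- n.+1 * (k * ((size s)%:R / (c / scale n)) `^ p))).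
  by rewrite ler_pM2l ?invr_gt0 ?exprn_gt0// H// divr_gt0.
rewrite invf_div !powRM ?invr_ge0 ?divr_ge0 ?(ltW c0) ?(ltW sc0)//.
rewrite powR_inv ?(ltW c0)// scaleK.
rewrite le_eqVlt; apply/orP; left; apply/eqP; field.
by rewrite expf_neq0//= lt0r_neq0// powR_gt0.
Qed.

Lemma block_fun1_tail_ge n i a : free_coords i ->
  weak_tail P p (block_fun n [:: i]) a -> 2 `^ (- p) <= a.
Proof.
move=> fi; have sc0 := scale_gt0 n.
(* The function has absolute value [scale n] on the whole block; half of that is a safe threshold
   for the strict inequality. *)
move=> /(_ (scale n / 2)); rewrite divr_gt0// => /(_ isT).
have -> : [set w | scale n / 2 < `|block_fun n [:: i] w|] =
    [set w | scale n / 2 < `|1 * block_fun n [:: i] w|].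
  by apply/seteqP; split=> w /=; rewrite mul1r.
rewrite block_fun_law// ?divr_gt0//; last by move=> j; rewrite /= inE => /eqP ->.
have -> : scale n / 2 / (1 * scale n) = 2^-1 by field; rewrite lt0r_neq0.
have -> : walk_tail 1 (2^-1 : R) = 1.
  have h : 2^-1 < 1 :> R by lra.
  rewrite /walk_tail /= add0r sub0r !indicE.
  rewrite (mem_set (u := 1)) ?(mem_set (u := -1)) /= ?normrN ?normr1//.
  by rewrite -[1%:R]/(1 : R); lra.
rewrite mulr1 lee_fin powRM// ?(ltW sc0)// scaleK powR_inv// powRN.
have p20 : 0 < 2 `^ p :> R by rewrite powR_gt0.
have -> : a / (2 ^+ n.+1 * (2 `^ p)^-1) = 2 ^- n.+1 * (a * 2 `^ p).
  by field; rewrite !lt0r_neq0 ?exprn_gt0.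
rewrite -[leLHS]mulr1 ler_pM2l ?invr_gt0 ?exprn_gt0//.
by rewrite -ler_pdivrMr// mul1r.
Qed.

(** The Paley-Zygmund bound at height [sqrt N / 2]: the norm is at least of order [sqrt N]. *)
Lemma block_fun_tail_ge n s a : (0 < size s)%N -> uniq s -> [set` s] `<=` free_coords ->
  weak_tail P p (block_fun n s) a ->
  (size s)%:R `^ (p / 2) <= 6 * 2 `^ p * a.
Proof.
move=> s0 us sJ; have sc0 := scale_gt0 n.
have N0 : 0 < (size s)%:R :> R by rewrite ltr0n.
set r := Num.sqrt (size s)%:R : R; have r0 : 0 < r by rewrite sqrtr_gt0.
move=> /(_ (scale n * (r / 2))); rewrite mulr_gt0 ?divr_gt0// => /(_ isT).
have -> : [set w | scale n * (r / 2) < `|block_fun n s w|] =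
    [set w | scale n * (r / 2) < `|1 * block_fun n s w|].
  by apply/seteqP; split=> w /=; rewrite mul1r.
rewrite block_fun_law// ?mulr_gt0 ?divr_gt0//.
have -> : scale n * (r / 2) / (1 * scale n) = r / 2 by field; rewrite lt0r_neq0.
rewrite lee_fin => H.
have {H} : 2 ^- n.+1 * 6^-1 <= a / (scale n * (r / 2)) `^ p.
  by apply: le_trans H; rewrite ler_pM2l ?invr_gt0 ?exprn_gt0// walk_tail_ge.
rewrite powRM ?divr_ge0 ?(ltW sc0) ?(ltW r0)// scaleK powRM ?(ltW r0)// powR_inv//.
have -> : r `^ p = (size s)%:R `^ (p / 2).
  by rewrite /r -powR12_sqrt ?ler0n// -powRrM mulrC.
set y := _ `^ (p / 2); have y0 : 0 < y by rewrite powR_gt0.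
have -> : a / (2 ^+ n.+1 * (y / 2 `^ p)) = 2 ^- n.+1 * (a * 2 `^ p / y).
  by field; rewrite !lt0r_neq0 ?powR_gt0 ?exprn_gt0.
rewrite ler_pM2l ?invr_gt0 ?exprn_gt0// ler_pdivlMr//.
by move=> ?; lra.
Qed.

(** The blocks are disjoint, so the tails add; each is at most [3 / c ^ p] times a term of the sum
    bounded by 4 in [sum_min_geometric_le4], whence 12. *)
Lemma block_fun_sum_tail M (a : nat -> R) (s : nat -> seq I) : p <= 2 ->
  (forall n, (n < M)%N -> [/\ 0 < a n, a n ^+ 2 * (size (s n))%:R <= 1, uniq (s n) &
     [set` s n] `<=` free_coords]) ->
  weak_tail P p (fun w => \sum_(0 <= n < M) a n * block_fun n (s n) w) 12.
Proof.
move=> p2 Hs c c0.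
pose s' n := if (n < M)%N then s n else [::].
rewrite measure_gt_abs_sum ?iota_uniq//; first last.
- move=> k l kl; rewrite -[RHS](measure0 P); congr (P _); apply/seteqP; split=> // w [/=].
  have nz j : a j * block_fun j (s j) w != 0 -> block j w.
    by rewrite mulf_eq0 negb_or => /andP[_]; exact: block_fun_neq0.
  by move=> /nz bk /nz; exact: block_disjoint bk.
- by move=> k; apply: measurable_funM => //; exact: measurable_block_fun.
have cp0 : 0 < c `^ p by rewrite powR_gt0.
apply: (@le_trans _ _ (\sum_(0 <= n < M)
   ((3 / c `^ p) * Num.min (2 / c `^ p * 2 ^+ n) (2 / c `^ p * 2 ^+ n)^-1)%:E)%E).
  rewrite big_nat [leRHS]big_nat; apply: lee_sum => n /andP[_ nM].
  have [an0 aN us sJ] := Hs n nM.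
  rewrite block_fun_law// lee_fin; set N := (size (s n)).
  have sc0 := scale_gt0 n.
  have x0 : 0 < c / (a n * scale n) by rewrite divr_gt0// mulr_gt0.
  have zE : 2 / c `^ p * 2 ^+ n = (scale n / c) `^ p.
    by rewrite powRM ?invr_ge0 ?(ltW sc0) ?(ltW c0)// powR_inv ?(ltW c0)// scaleK exprS mulrAC.
  set y := scale n / c in zE *; have y0 : 0 < y by rewrite divr_gt0.
  have -> : 2 ^- n.+1 = (c `^ p)^-1 * (y `^ p)^-1.
    by rewrite -zE exprS; field; rewrite lt0r_neq0//= expf_neq0.
  rewrite zE; set z := y `^ p; have z0 : 0 < z by rewrite powR_gt0.
  rewrite [3 / _]mulrC -!mulrA ler_pM2l ?invr_gt0//.
  (* For [y >= 1] the trivial bound 1 on the tail suffices. For [y < 1] the fourth moment gives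
     [3 * y ^+ 4], at most [3 * z ^+ 2] since [p <= 2]. *)
  have [y1|y1] := leP 1 y.
    have z1 : 1 <= z.
      have p1 : 1 `^ p = 1 :> R by rewrite powR1.
      by rewrite -[leLHS]p1; apply: ge0_ler_powR; rewrite ?nnegrE ?(ltW p0) ?(ltW y0).
    have -> : Num.min z z^-1 = z^-1.
      by apply/min_idPr; rewrite (le_trans _ z1)// invf_le1.
    rewrite mulrC ler_pM2r ?invr_gt0// (le_trans (walk_tail_le1 _ _))//.
    by rewrite ler1n.
  have z2 : y ^+ 4 <= z ^+ 2.
    rewrite /z -!powR_mulrn ?powR_ge0 ?(ltW y0)// -powRrM.
    by apply: ger_powR; [rewrite y0 ltW|lra].
  have W : walk_tail N (c / (a n * scale n)) <= 3 * z ^+ 2.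
    apply: (le_trans (walk_tail_le4 N x0)).
    have -> : 3 * N%:R ^+ 2 / (c / (a n * scale n)) ^+ 4 =
       3 * ((a n ^+ 2 * N%:R) ^+ 2 * y ^+ 4).
      by rewrite /y; field; rewrite !lt0r_neq0.
    rewrite ler_pM2l// (le_trans _ z2)// -[leRHS]mul1r.
    rewrite ler_wpM2r ?exprn_ge0 ?(ltW y0)// expr_le1//.
    by rewrite mulr_ge0 ?sqr_ge0.
  rewrite minEle; case: ifP => _.
    rewrite mulrC ler_pdivrMr// (le_trans W)// -mulrA expr2//.
  rewrite mulrC ler_pM2r ?invr_gt0// (le_trans (walk_tail_le1 _ _))//.
  by rewrite ler1n.
rewrite sumEFin lee_fin -mulr_sumr.
have -> : 12 / c `^ p = 3 / c `^ p * 4 by field; rewrite lt0r_neq0.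
by rewrite ler_pM2l ?divr_gt0// sum_min_geometric_le4// divr_gt0.
Qed.

End block_fun.

(** * Purely atomic measures *)

Section purely_atomic.
Context {R : realType} d {T : measurableType d}.
Variable mu : {measure set T -> \bar R}.
Implicit Types (A B E : set T).

(* An atom or a null set. *)
Definition weak_atom A := measurable A /\
  forall B, measurable B -> B `<=` A -> mu B = 0%E \/ mu (A `\` B) = 0%E.

(** No measurability is asked of [E], so covers pass to all subsets. *)
Definition atomic_cover E :=
  exists A : (set T)^nat, (forall n, weak_atom (A n)) /\ E `<=` \bigcup_n A n.

Lemma measure_sub0 A B : measurable A -> measurable B -> A `<=` B ->
  mu B = 0%E -> mu A = 0%E.
Proof.
move=> mA mB AB B0; apply/eqP; rewrite eq_le measure_ge0 andbT -B0.
by rewrite le_measure ?inE.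
Qed.

Lemma atomic_cover_sub A B : A `<=` B -> atomic_cover B -> atomic_cover A.
Proof. by move=> AB [F [wF BF]]; exists F; split=> //; apply: subset_trans BF. Qed.

Lemma weak_atom0 A : measurable A -> mu A = 0%E -> weak_atom A.
Proof. by move=> mA A0; split=> // B mB BA; left; apply: measure_sub0 A0. Qed.

Lemma weak_atom_cover A : weak_atom A -> atomic_cover A.
Proof. by move=> wA; exists (fun=> A); split=> // x Ax; exists 0%N. Qed.

Lemma atomic_cover_bigcup (E : (set T)^nat) :
  (forall n, atomic_cover (E n)) -> atomic_cover (\bigcup_n E n).
Proof.
move=> /choice[A AE].
(* The double sequence is enumerated through codes of pairs; other codes give the empty set. *)
exists (fun m => if @unpickle (nat * nat)%type m is Some kn then A kn.1 kn.2 else set0).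
split=> [m|x [n _ Enx]].
  case: unpickle => [[k n]|]; first by have [] := AE k.
  by apply: weak_atom0 => //; exact: measure0.
have [_ /(_ x Enx)[k _ Ax]] := AE n.
by exists (pickle (n, k)) => //; rewrite pickleK.
Qed.

Hypothesis pa : purely_atomic mu.

(* Such sets form a sigma-algebra. *)
Lemma atomic_coverVC E : measurable E -> atomic_cover E \/ atomic_cover (~` E).
Proof.
have : measurable `<=` [set E | atomic_cover E \/ atomic_cover (~` E)]; last by apply.
rewrite pa; apply: smallest_sub; last first.
  move=> A [[mA _ atA]|[mA A0]]; left; apply: weak_atom_cover => //.
  exact: weak_atom0.
split=> /=.
- by left; apply: weak_atom_cover; apply: weak_atom0 => //; exact: measure0.
- by move=> A; rewrite setTD setCK => -[]; [right|left].
(* One coverable complement covers the complement of the union; otherwise every [F n] is coverable,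
   and so is the union. *)
- move=> F HF; have [[n cF]|nF] := pselect (exists n, atomic_cover (~` F n)).
    by right; apply: atomic_cover_sub cF; apply: subsetC; exact: bigcup_sup.
  left; apply: atomic_cover_bigcup => n.
  by case: (HF n) => // ?; exfalso; apply: nF; exists n.
Qed.

(* Remove from [E] a coverable subset of maximal measure: each measurable part of the rest
   is null or conull in it, so the rest is a weak atom. *)
Lemma finite_measure_atomic_cover E : measurable E -> (mu E < +oo)%E ->
  atomic_cover E.
Proof.
move=> mE Efin.
pose S := [set mu B | B in [set B | [/\ measurable B, B `<=` E & atomic_cover B]]].
have S0 : S (mu set0).
  by exists set0 => //; split=> //; apply/weak_atom_cover/weak_atom0/measure0.
have SE : (ereal_sup S <= mu E)%E.
  by apply: ge_ereal_sup => _ [B [mB BE _] <-]; rewrite le_measure ?inE.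
have Sfin : ereal_sup S \is a fin_num.
  rewrite ge0_fin_numE; first exact: le_lt_trans SE Efin.
  by rewrite -(measure0 mu); exact: ereal_sup_ubound.
(* [B n] comes within [1 / n.+1] of the supremum, so the union [F] attains it. *)
have /choice[B HB] n : exists B, [/\ measurable B, B `<=` E, atomic_cover B &
    (ereal_sup S - n.+1%:R^-1%:E < mu B)%E].
  have [|_ [B [mB BE cB] <-] ?] := @ub_ereal_sup_adherent _ S n.+1%:R^-1 _ Sfin.
    by rewrite invr_gt0.
  by exists B.
pose F := \bigcup_n B n.
have mF : measurable F by apply: bigcup_measurable => n _; have [] := HB n.
have FE : F `<=` E by move=> x [n _]; have [_ + _ _] := HB n; exact.
have cF : atomic_cover F by apply: atomic_cover_bigcup => n; have [] := HB n.
have muF : mu F = ereal_sup S.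
  apply/eqP; rewrite eq_le; apply/andP; split; first by apply: ereal_sup_ubound; exists F.
  apply/lee_addgt0Pr => e e0.
  have [n ne] : exists n : nat, n.+1%:R^-1 < e.
    by have [n _ /(_ n (leqnn n))] := near_infty_natSinv_lt (PosNum e0); exists n.
  have [mB _ _ /ltW] := HB n; rewrite leeBlDr//= => /le_trans; apply.
  apply: leeD; last by rewrite lee_fin ltW.
  by rewrite le_measure ?inE//; exact: bigcup_sup.
(* By maximality of [F], adding a coverable set outside it cannot increase the measure. *)
have null B' : measurable B' -> B' `<=` E `\` F -> atomic_cover B' -> mu B' = 0%E.
  move=> mB BEF cB.
  have muFB : mu (F `|` B') = (mu F + mu B')%E.
    by apply: measureU => //; apply/seteqP; split=> // x [Fx /BEF[]].
  have : (mu F + mu B' <= mu F + 0)%E.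
    rewrite -muFB adde0 muF; apply: ereal_sup_ubound; exists (F `|` B') => //; split.
    - exact: measurableU.
    - by move=> x [/FE//|/BEF[]].
    - apply: (@atomic_cover_sub _ (\bigcup_n (if n is 0%N then F else B'))).
        by move=> x [?|?]; [exists 0%N|exists 1%N].
      by apply: atomic_cover_bigcup => -[].
  rewrite leeD2lE ?muF// => B0.
  by apply/eqP; rewrite eq_le B0 measure_ge0.
have wEF : weak_atom (E `\` F).
  split=> [|B' mB BEF]; first exact: measurableD.
  have [cB|cB] := atomic_coverVC mB; [left|right]; apply: null => //.
  - by apply: measurableD => //; exact: measurableD.
  - by apply: atomic_cover_sub cB => x [_].
apply: (@atomic_cover_sub _ (\bigcup_n (if n is 0%N then F else E `\` F))).
  by move=> x Ex; have [Fx|nFx] := pselect (F x); [exists 0%N|exists 1%N].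
by apply: atomic_cover_bigcup => -[|n] //; exact: weak_atom_cover.
Qed.

End purely_atomic.

(** * Images of the block functions *)

Lemma measure_bigcup0 (R : realType) d (T : measurableType d)
  (mu : {measure set T -> \bar R}) (F : (set T)^nat) :
  (forall n, measurable (F n)) -> (forall n, mu (F n) = 0%E) ->
  mu (\bigcup_n F n) = 0%E.
Proof.
move=> mF F0; apply: measure_negligible; first exact: bigcup_measurable.
by apply: negligible_bigcup => n; apply/negligibleP; [exact: mF|exact: F0].
Qed.

(** Pigeonhole: a countable union of countable fibers would be countable. *)
Lemma uncountable_fiber (I : Type) (K : countType) (Z : set I) (q : I -> K) :
  ~ countable Z -> exists t, ~ countable (Z `&` [set i | q i = t]).
Proof.
move=> Zunc; apply: contrapT => H; apply: Zunc.
have -> : Z = \bigcup_(t in [set: K]) (Z `&` [set i | q i = t]).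
  by apply/seteqP; split=> [i Zi|i [t _ []]//]; exists (q i).
apply: bigcup_countable => [|t _]; first exact: countableP.
by apply: contrapT => nt; apply: H; exists t.
Qed.

Section embedding.
Context {R : realType} {I : choiceType} {d : measure_display} {T : measurableType d}.
Variables (P : {measure set (cube I) -> \bar R}) (mu : {measure set T -> \bar R}).
Variables (p : R) (J : nat -> I).
Hypotheses (coinP : coin_product P) (p0 : 0 < p) (injJ : injective J).
Variables (L : (cube I -> R) -> (T -> R)) (D : R).
Hypotheses (D0 : 0 < D)
  (L_measurable : forall f, weakLp P p f -> measurable_fun setT (L f))
  (L_linear : forall f g (a b : R), weakLp P p f -> weakLp P p g ->
     {ae mu, forall x, L (fun y => a * f y + b * g y) x = a * L f x + b * L g x})
  (L_bounded : forall f (a : R), weakLp P p f -> 0 <= a ->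
     weak_tail P p f a -> weak_tail mu p (L f) (D * a))
  (L_bounded_below : forall f (a : R), weakLp P p f -> 0 <= a ->
     weak_tail mu p (L f) a -> weak_tail P p f (D * a)).

(** A class closed under finite linear combinations and, [P] being a probability, contained in weak
    L^p. *)
Let bounded_measurable (f : cube I -> R) :=
  measurable_fun setT f /\ exists B : R, forall w, `|f w| <= B.

Lemma bounded_weakLp f : bounded_measurable f -> weakLp P p f.
Proof.
move=> [mf [B fB]]; apply: (@weak_tail_weakLp _ _ _ _ _ p0 _ (Num.max 0 B `^ p)) => //.
  exact: powR_ge0.
apply: bounded_tail => //; first by rewrite le_max lexx.
by move=> w; rewrite le_max fB orbT.
Qed.

Lemma bounded_measurable_block_fun n s : bounded_measurable (block_fun p J n s).
Proof.
split; first exact: measurable_block_fun.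
by exists (scale p n * (size s)%:R) => w; exact: block_fun_bounded.
Qed.

Lemma bounded_measurable_sum (K : Type) (r : seq K) (a : K -> R) f :
  (forall k, bounded_measurable (f k)) ->
  bounded_measurable (fun w => \sum_(k <- r) a k * f k w).
Proof.
move=> bf; split.
  by apply: measurable_sum => k; have [mf _] := bf k; exact: measurable_funM.
have /choice[B fB] k : exists B, forall w, `|f k w| <= B by case: (bf k).
exists (\sum_(k <- r) `|a k| * B k) => w.
by rewrite (le_trans (ler_norm_sum _ _ _))// ler_sum// => k _; rewrite normrM ler_wpM2l.
Qed.

Lemma L_sum (K : Type) (r : seq K) (a : K -> R) f :
  (forall k, bounded_measurable (f k)) ->
  {ae mu, forall x, L (fun w => \sum_(k <- r) a k * f k w) x =
    \sum_(k <- r) a k * L (f k) x}.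
Proof.
move=> bf; elim: r => [|k r IH].
  have b0 : bounded_measurable (fun=> 0).
    by split=> //; exists 0 => w; rewrite normr0.
  (* Linearity with zero coefficients shows that the image of 0 vanishes almost everywhere. *)
  have := @L_linear _ _ 0 0 (bounded_weakLp b0) (bounded_weakLp b0).
  have -> : (fun w => \sum_(k <- [::]) a k * f k w) = (fun w => 0 * 0 + 0 * 0).
    by apply/funext => w; rewrite big_nil mul0r addr0.
  by apply: filterS => x ->; rewrite big_nil !mul0r addr0.
have := @L_linear _ _ (a k) 1 (bounded_weakLp (bf k))
  (bounded_weakLp (bounded_measurable_sum r a bf)).
apply: filterS2 IH => x IH; rewrite mul1r IH big_cons => <-; congr (L _ _).
by apply/funext => w; rewrite big_cons mul1r.
Qed.

Let u n i := L (block_fun p J n [:: i]).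

Lemma measurable_image n s : measurable_fun setT (L (block_fun p J n s)).
Proof. exact/L_measurable/bounded_weakLp/bounded_measurable_block_fun. Qed.

(* If many [u n i] were at least [c] in absolute value on the atom [A] they could be
   chosen with a constant sign, so that the image of [N] of them would be at least [N c]
   on [A]; but the sum of [N] Rademacher functions has norm [o(N)]. *)
Lemma countable_nonnull_on_atom A n : weak_atom mu A ->
  countable (free_coords J `&` [set i | mu (A `&` [set x | u n i x != 0]) != 0%E]).
Proof.
move=> [mA atA]; apply: contrapT => unc.
have mu_i i : measurable_fun setT (u n i) by exact: measurable_image.
(* The pair [mb] encodes a level [1 / mb.1.+1] and a sign. *)
pose E (mb : nat * bool) i := [set x | mb.1.+1%:R^-1 < (-1) ^+ mb.2 * u n i x].
have mE mb i : measurable (E mb i).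
  rewrite -[X in measurable X]setTI.
  have -> : E mb i = (fun x => (-1) ^+ mb.2 * u n i x) @^-1` `]mb.1.+1%:R^-1, +oo[.
    by apply/seteqP; split=> x /=; rewrite in_itv/= andbT.
  by apply: measurable_funM.
(* The set where [u n i] is nonzero is the countable union of the [E mb i], so one of them is not
   null on [A]. *)
have /choice[q qP] i : exists mb, mu (A `&` [set x | u n i x != 0]) != 0%E ->
    mu (A `&` E mb i) != 0%E.
  apply: contrapT => /forallNP H.
  have E0 mb : mu (A `&` E mb i) = 0%E.
    by apply: contrapT => /eqP ?; apply: (H mb).
  apply: (H (0%N, true)) => /eqP[].
  apply: (@measure_sub0 _ _ _ _ _ (\bigcup_k ((A `&` E (k, true) i) `|` (A `&` E (k, false) i)))).
  - by apply: measurableI => //; exact: measurable_neq0.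
  - by apply: bigcup_measurable => k _; apply: measurableU; exact: measurableI.
  - move=> x [Ax /= ux]; have : 0 < `|u n i x| by rewrite normr_gt0.
    move=> ux0; have [k _ /(_ k (leqnn k))/= kx] := near_infty_natSinv_lt (PosNum ux0).
    exists k => //; move: kx; rewrite /E/= expr1 expr0 mulN1r mul1r.
    by case: (ler0P (u n i x)) => _ ?; [left|right].
  - apply: measure_bigcup0 => k; first by apply: measurableU; exact: measurableI.
    by rewrite measureU0 ?E0//; exact: measurableI.
have [mb /= Zunc] := uncountable_fiber q unc.
set Z := _ `&` _ in Zunc.
have Zinf : infinite_set Z by move=> /finite_set_countable.
have A0 : mu A = 0%E.
  apply/eqP; rewrite eq_le measure_ge0 andbT.
  apply/lee_addgt0Pr => /= e e0; rewrite add0e.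
  (* Chosen so that the tail bound for the image, at height [size s / mb.1.+1], is exactly [e]. *)
  pose k := e / (D * mb.1.+1%:R `^ p).
  have mp0 : 0 < mb.1.+1%:R `^ p :> R by rewrite powR_gt0.
  have k0 : 0 < k by rewrite divr_gt0// mulr_gt0.
  have [N0 [N00 HN]] := block_fun_tail_small coinP p0 injJ k0.
  have [B BZ NB] := infinite_set_fset N0 Zinf.
  pose s := finmap.enum_fset B.
  have us : uniq s by exact: finmap.fset_uniq.
  have sJ : [set` s] `<=` free_coords J by move=> i /BZ [[]].
  have := L_bounded (bounded_weakLp (bounded_measurable_block_fun n s)) _ (HN n s NB us sJ).
  rewrite mulr_ge0 ?powR_ge0 ?(ltW k0)// => /(_ isT).
  have S0 : 0 < (size s)%:R :> R by rewrite ltr0n (leq_trans N00).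
  move=> /(_ ((size s)%:R * mb.1.+1%:R^-1)); rewrite mulr_gt0 ?invr_gt0// => /(_ isT).
  have -> : D * (k * (size s)%:R `^ p) / ((size s)%:R / mb.1.+1%:R) `^ p = e.
    rewrite powRM// powR_inv// /k; field.
    by rewrite !lt0r_neq0 ?powR_gt0.
  apply: le_trans; apply: le_measure_ae => //.
    by apply: measurable_gt_abs; exact: measurable_image.
  (* [E mb i] is not null on [A], hence fills it up to a null set, because [A] is an atom. *)
  have aeE : {ae mu, forall x i, i \in s -> A x -> E mb i x}.
    apply: ae_seq => i /BZ [[_ nz] qi]; apply: ae_imply_of_null => //.
    have [z|] := atA _ (measurableI _ _ mA (mE mb i)) (@subIsetl _ _ _).
      by move: (qP i nz); rewrite qi z eqxx.
    by rewrite setDIr setDv set0U.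
  have := L_sum s (fun=> 1) (fun i => bounded_measurable_block_fun n [:: i]).
  apply: filterS2 aeE => x Es Lx Ax /=.
  have -> : block_fun p J n s = fun w => \sum_(i <- s) 1 * block_fun p J n [:: i] w.
    by apply/funext => w; rewrite block_fun_seq; apply: eq_bigr => i _; rewrite mul1r.
  rewrite Lx.
  suff : (size s)%:R / mb.1.+1%:R < (-1) ^+ mb.2 * \sum_(i <- s) 1 * u n i x.
    move=> /lt_le_trans; apply; rewrite (le_trans (ler_norm _))//.
    by rewrite normrM normrX normrN1 expr1n mul1r.
  rewrite mulr_sumr.
  have s0 : (0 < size s)%N by exact: leq_trans NB.
  have {}Es i : i \in s -> mb.1.+1%:R^-1 < (-1) ^+ mb.2 * (1 * u n i x).
    by move=> si; rewrite mul1r; exact: Es.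
  move: s0 Es; move: (s) => r r0 Er.
  have ge_sum : forall t, {subset t <= r} ->
      (size t)%:R / mb.1.+1%:R <= \sum_(i <- t) (-1) ^+ mb.2 * (1 * u n i x).
    elim=> [|i t IH] tr; first by rewrite big_nil mul0r.
    rewrite big_cons /= -natr1 mulrDl mul1r addrC lerD//.
      by rewrite ltW// Er// tr// mem_head.
    by apply: IH => j jt; rewrite tr// inE jt orbT.
  case: r r0 Er ge_sum => // i t _ Er ge_sum.
  rewrite big_cons /= -natr1 mulrDl mul1r addrC ltr_leD//.
    by rewrite Er ?mem_head.
  by apply: ge_sum => j jt; rewrite inE jt orbT.
have [i [[_ nz] _]] := infinite_setN0 Zinf.
case/eqP: nz; apply: (measure_sub0 _ mA _ A0); last by move=> x [].
by apply: measurableI => //; exact: measurable_neq0.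
Qed.

(** * Images with almost disjoint supports *)

Hypothesis pa : purely_atomic mu.

(** The support is the union of the sets where [|f| > 1 / k.+1], each of finite measure. *)
Lemma weak_tail_atomic_cover f a : measurable_fun setT f -> weak_tail mu p f a ->
  atomic_cover mu [set x | f x != 0].
Proof.
move=> mf tf; apply: (@atomic_cover_sub _ _ _ _ _ (\bigcup_k [set x | k.+1%:R^-1 < `|f x|])).
  move=> x; rewrite /= -normr_gt0 => fx0.
  by have [k _ /(_ k (leqnn k))/= kx] := near_infty_natSinv_lt (PosNum fx0); exists k.
apply: atomic_cover_bigcup => k; apply: finite_measure_atomic_cover => //.
  exact: measurable_gt_abs.
by apply: (le_lt_trans (tf _ _)); rewrite ?ltry// invr_gt0.
Qed.

Lemma image_atomic_cover n i : atomic_cover mu [set x | u n i x != 0].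
Proof.
apply: weak_tail_atomic_cover; first exact: measurable_image.
apply: (@L_bounded _ ((scale p n * (size [:: i])%:R) `^ p)).
- exact/bounded_weakLp/bounded_measurable_block_fun.
- exact: powR_ge0.
apply: bounded_tail => //; first last.
- by move=> w; exact: block_fun_bounded.
- exact: measurable_block_fun.
- by rewrite mulr_ge0// ltW// scale_gt0.
Qed.

(** The supports of the [u k i], for fixed [i], are covered by countably many atoms, each met by
    [u l j] for only countably many [j]; a greedy choice then applies. *)
Lemma disjoint_images (Z : set I) : ~ countable Z -> Z `<=` free_coords J ->
  exists x : nat -> I, [/\ injective x, forall n, Z (x n) &
    forall k l m n, m != n ->
      mu ([set y | u k (x m) y != 0] `&` [set y | u l (x n) y != 0]) = 0%E].
Proof.
move=> Zunc ZJ.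
(* Including [i] itself makes the chosen sequence injective. *)
pose C i := [set i] `|` [set j | exists k l,
  mu ([set y | u k i y != 0] `&` [set y | u l j y != 0]) <> 0%E].
have mneq k i : measurable [set y | u k i y != 0].
  by apply: measurable_neq0; exact: measurable_image.
have [i _|x [Zx Cx]] := free_sequence (C := C) Zunc.
  have /choice[A AP] := fun k => image_atomic_cover k i.
  (* [None] stands for [i] itself, [Some (k, m, l)] for the [j] whose [u l j] is not null on the
     [m]-th covering atom of [u k i]. *)
  pose F (t : option (nat * nat * nat)) : set I := if t is Some (k, m, l) then
    free_coords J `&` [set j | mu (A k m `&` [set y | u l j y != 0]) != 0%E] else [set i].
  apply: (@sub_countable _ _ _ (\bigcup_t F t)).
    apply: subset_card_le => j [[->|[k [l kl]]] Zj]; first by exists None.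
    apply: contrapT => H; apply: kl.
    have mA m : measurable (A k m) by have [/(_ m)[]] := AP k.
    apply: (@measure_sub0 _ _ _ _ _ (\bigcup_m (A k m `&` [set y | u l j y != 0]))).
    - exact: measurableI.
    - by apply: bigcup_measurable => m _; exact: measurableI.
    - by move=> y [uy uly]; have [_ /(_ y uy)[m _ Am]] := AP k; exists m.
    - apply: measure_bigcup0 => m; first exact: measurableI.
      apply: contrapT => /eqP nz; apply: H; exists (Some (k, m, l)) => //; split=> //.
      exact: ZJ.
  apply: bigcup_countable => [|[[[k m] l]|] _ /=]; [exact: countableP| |exact: countable1].
  by apply: countable_nonnull_on_atom; have [/(_ m)] := AP k.
have xdisj k l m n : (m < n)%N ->
    mu ([set y | u k (x m) y != 0] `&` [set y | u l (x n) y != 0]) = 0%E.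
  by move=> /Cx Cmn; apply: contrapT => nz; apply: Cmn; right; exists k, l.
exists x; split=> //.
  move=> m n xmn; case: (ltngtP m n) => // /Cx Cmn; exfalso; apply: Cmn; left => /=.
    by rewrite xmn.
  by rewrite xmn.
move=> k l m n; rewrite neq_ltn => /orP[|] mn; first exact: xdisj.
by rewrite setIC; exact: xdisj.
Qed.

(** * The case [p > 2]: disjoint images against square-root growth *)

Lemma no_embedding_gt2 : 2 < p -> countable (free_coords J).
Proof.
move=> p2; apply: contrapT => unc.
have [//|x [injx Zx disj]] := disjoint_images unc.
pose q := p / 2 - 1; have q0 : 0 < q by rewrite /q; lra.
(* The two bounds give [N ^ (1 + q) <= N * K], and [N > K ^ (1 / q)] contradicts this. The factor
   [D * 2] bounds each image, since [scale 0 ^ p = 2]; the other [D] comes from the lower bound on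
   [L]. *)
pose K : R := 6 * 2 `^ p * (D * (D * 2)).
pose N := (Num.truncn (K `^ q^-1)).+1.
have N0 : 0 < N%:R :> R by rewrite ltr0n.
have uN : uniq (mkseq x N) by rewrite mkseq_uniq.
have sJ : [set` mkseq x N] `<=` free_coords J by move=> i /= /mapP[k _ ->].
pose G := L (block_fun p J 0 (mkseq x N)).
have GE : {ae mu, forall y, G y = \sum_(k <- iota 0 N) u 0 (x k) y}.
  have := L_sum (iota 0 N) (fun=> 1) (fun k => bounded_measurable_block_fun 0 [:: x k]).
  apply: filterS => y; rewrite /G.
  under [RHS]eq_bigr do rewrite mul1r; move=> <-; congr (L _ _).
  apply/funext => w; rewrite block_fun_seq big_map.
  by apply: eq_bigr => k _; rewrite mul1r.
have ut k : weak_tail mu p (u 0 (x k)) (D * 2).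
  apply: L_bounded => //; first exact/bounded_weakLp/bounded_measurable_block_fun.
  have -> : 2 = (scale p 0 * (size [:: x k])%:R) `^ p :> R by rewrite mulr1 scaleK.
  apply: bounded_tail => //; [|exact: measurable_block_fun|exact: block_fun_bounded].
  by rewrite mulr_ge0// ltW// scale_gt0.
have mu0 k : measurable_fun setT (u 0 (x k)) by exact: measurable_image.
have Gt : weak_tail mu p G (N%:R * (D * 2)).
  move=> c c0.
  have -> : mu [set y | c < `|G y|] = mu [set y | c < `|\sum_(k <- iota 0 N) u 0 (x k) y|].
    apply: eq_measure_ae.
    - by apply: measurable_gt_abs; exact: measurable_image.
    - by apply: measurable_gt_abs; exact: measurable_sum.
    - by apply: filterS GE => y /= ->.
  rewrite measure_gt_abs_sum ?iota_uniq//; last by move=> k l; exact: disj.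
  apply: (@le_trans _ _ (\sum_(k <- iota 0 N) (D * 2 / c `^ p)%:E)%E).
    by apply: lee_sum => k _; exact: ut.
  rewrite sumEFin lee_fin big_const_seq count_predT size_iota iter_addr_0.
  by rewrite -[leLHS]mulr_natl !mulrA.
have {}Gt := L_bounded_below (bounded_weakLp (bounded_measurable_block_fun 0 (mkseq x N))) _ Gt.
have {}Gt := Gt (mulr_ge0 (ltW N0) (mulr_ge0 (ltW D0) (ler0n _ 2))).
have := block_fun_tail_ge coinP p0 injJ _ uN sJ Gt; rewrite size_mkseq => /(_ isT).
have -> : p / 2 = 1 + q by rewrite /q; ring.
rewrite powRD; last by rewrite lt0r_neq0// implybT.
rewrite powRr1 ?ler0n//.
have -> : 6 * 2 `^ p * (D * (N%:R * (D * 2))) = N%:R * K by rewrite /K; ring.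
rewrite ler_pM2l// leNgt => /negP; apply.
have K0 : 0 <= K by rewrite !mulr_ge0 ?powR_ge0 ?(ltW D0).
have -> : K = (K `^ q^-1) `^ q by rewrite -powRrM mulVf ?lt0r_neq0// powRr1.
by apply: gt0_ltr_powR; rewrite ?nnegrE ?powR_ge0// truncnS_gt.
Qed.

(** * The case [p <= 2]: many blocks at common levels *)

Let delta : R := 2 `^ (- p) / (D * 2 `^ p) / 2.

Let delta0 : 0 < delta.
Proof. by rewrite !divr_gt0 ?mulr_gt0 ?powR_gt0. Qed.

(** Otherwise, rounding each [c] to a rational in [(c / 2, c)] costs a factor [2 ^ p] and yields a
    tail bound that, pulled back with the factor [D], is half of what [block_fun1_tail_ge] requires.
    Rational levels allow the later pigeonhole argument. *)
Lemma rational_level n i : free_coords J i -> exists q : rat, 0 < (ratr q : R) /\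
  ((delta / ratr q `^ p)%:E < mu [set x | (ratr q < `|u n i x|)%R])%E.
Proof.
move=> fi; apply: contrapT => /forallNP H.
have mui : measurable_fun setT (u n i) by exact: measurable_image.
have tail : weak_tail mu p (u n i) (delta * 2 `^ p).
  move=> c c0; have c2c : c / 2 < c by lra.
  have [q] := rat_in_itvoo c2c; rewrite in_itv/= => /andP[cq qc].
  have q0 : 0 < ratr q :> R by rewrite (lt_trans _ cq)// divr_gt0.
  apply: (@le_trans _ _ (mu [set x | ratr q < `|u n i x|])).
    rewrite le_measure ?inE//; [exact: measurable_gt_abs|exact: measurable_gt_abs|].
    by move=> x /=; exact: lt_trans.
  apply: (@le_trans _ _ (delta / ratr q `^ p)%:E).
    by rewrite leNgt; apply/negP => lt; apply: (H q).
  have -> : delta * 2 `^ p / c `^ p = delta / (c / 2) `^ p.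
    by rewrite powRM ?(ltW c0)// powR_inv// invf_div mulrA.
  rewrite lee_fin ler_pM2l// lef_pV2 ?posrE ?powR_gt0 ?(divr_gt0 c0)//.
  apply: ge0_ler_powR; rewrite ?nnegrE ?(ltW p0) ?(ltW q0)//.
    by rewrite divr_ge0// ltW.
  exact: ltW.
have := block_fun1_tail_ge coinP p0 injJ fi
  (L_bounded_below (bounded_weakLp (bounded_measurable_block_fun n [:: i]))
    (mulr_ge0 (ltW delta0) (powR_ge0 _ _)) tail).
have -> : D * (delta * 2 `^ p) = 2 `^ (- p) / 2.
  by rewrite /delta; field; rewrite !lt0r_neq0 ?powR_gt0.
have : 0 < 2 `^ (- p) :> R by rewrite powR_gt0.
by move=> ? ?; lra.
Qed.

Lemma no_embedding_le2 : p <= 2 -> countable (free_coords J).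
Proof.
move=> p2; apply: contrapT => unc.
have /choice[q qP] (ni : nat * I) : exists q : rat, free_coords J ni.2 ->
    0 < (ratr q : R) /\
    ((delta / ratr q `^ p)%:E < mu [set x | (ratr q < `|u ni.1 ni.2 x|)%R])%E.
  have [/(rational_level ni.1)[q]|?] := pselect (free_coords J ni.2); first by exists q.
  by exists 0.
(* Ensures [M * delta / 2 > 12 * D], where 12 is the bound of [block_fun_sum_tail]. *)
pose M := (Num.truncn (24 * D / delta)).+1.
(* Lists of rationals are countable, so uncountably many [i] share their levels on all of the first
   [M] blocks. *)
have [t Zunc] := uncountable_fiber (fun i => mkseq (fun n => q (n, i)) M) unc.
set Z := _ `&` _ in Zunc.
have [|x [injx Zx disj]] := disjoint_images Zunc; first by move=> i [].
pose l n : R := ratr (nth 0 t n).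
have lP n m : (n < M)%N -> 0 < l n /\
    ((delta / l n `^ p)%:E < mu [set y | (l n < `|u n (x m) y|)%R])%E.
  move=> nM; have [fx tx] := Zx m.
  have := qP (n, x m) fx; rewrite /l -tx nth_mkseq//.
move: l lP => l lP.
have [rho [rho0 rhol]] : exists rho : R, 0 < rho /\ forall n, (n < M)%N -> rho <= l n.
  have : (M <= M)%N by [].
  elim: {-2}M => [|m IH] mM; first by exists 1.
  have [r [r0 rl]] := IH (ltnW mM).
  exists (Num.min r (l m)); split; first by rewrite lt_min r0; case: (lP m 0 mM).
  move=> n; rewrite ltnS leq_eqVlt => /predU1P[->|/rl rn].
    by rewrite ge_min lexx orbT.
  by rewrite ge_min rn.
pose Y n := (l n / rho) `^ p.
pose N n := Num.truncn (Y n).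
(* With this weight, [a n * u n i] exceeds [rho] in absolute value exactly where [u n i] exceeds
   [l n]. The value 1 is a default outside the range of summation. *)
pose a n := if (n < M)%N then rho / l n else 1.
(* Distinct pairs get distinct terms of [x], so all summands of the image of [F] have almost
   disjoint supports. *)
pose z (n k : nat) := x (pickle (n, k)).
pose r := [seq (n, k) | n <- iota 0 M, k <- iota 0 (N n)].
pose s n := mkseq (z n) (N n).
pose F w := \sum_(nk <- r) a nk.1 * block_fun p J nk.1 [:: z nk.1 nk.2] w.
have injz n : injective (z n) by move=> k k' /injx /(pcan_inj pickleK)[].
have zJ n k : free_coords J (z n k) by have [] := Zx (pickle (n, k)).
have FE : F = fun w => \sum_(0 <= n < M) a n * block_fun p J n (s n) w.
  apply/funext => w; rewrite /F big_allpairs_dep /index_iota subn0.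
  by apply: eq_bigr => n _; rewrite block_fun_seq big_map mulr_sumr.
have Yge1 n : (n < M)%N -> 1 <= Y n.
  move=> nM; have p1 : 1 `^ p = 1 :> R by rewrite powR1.
  rewrite -[leLHS]p1; have [l0 _] := lP n 0 nM.
  apply: ge0_ler_powR; rewrite ?nnegrE ?(ltW p0) ?divr_ge0 ?(ltW l0) ?(ltW rho0)//.
  by rewrite ler_pdivlMr// mul1r rhol.
have tF : weak_tail P p F 12.
  rewrite FE; apply: block_fun_sum_tail => // n nM.
  have [l0 _] := lP n 0 nM; have al : a n = rho / l n by rewrite /a nM.
  split.
  - by rewrite al divr_gt0.
  - rewrite size_mkseq al; set v := l n / rho.
    have v1 : 1 <= v by rewrite ler_pdivlMr// mul1r rhol.
    have v0 : 0 < v by rewrite divr_gt0.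
    have -> : rho / l n = v^-1 by rewrite invf_div.
    rewrite exprVn mulrC ler_pdivrMr ?exprn_gt0// mul1r.
    apply: (@le_trans _ _ (Y n)); first by rewrite truncn_le// (le_trans _ (Yge1 n nM)).
    by rewrite -powR_mulrn ?(ltW v0)// /Y -/v ler_powR.
  - by rewrite mkseq_uniq.
  - by move=> i /= /mapP[k _ ->].
have bF : bounded_measurable F.
  by apply: bounded_measurable_sum => nk; exact: bounded_measurable_block_fun.
have := L_bounded (bounded_weakLp bF) (ler0n _ 12) tF rho0.
have mf nk : measurable_fun setT (fun y => a nk.1 * u nk.1 (z nk.1 nk.2) y).
  by apply: measurable_funM => //; exact: measurable_image.
have -> : mu [set y | rho < `|L F y|] =
    mu [set y | rho < `|\sum_(nk <- r) a nk.1 * u nk.1 (z nk.1 nk.2) y|].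
  apply: eq_measure_ae.
  - by apply: measurable_gt_abs; exact/L_measurable/bounded_weakLp.
  - by apply: measurable_gt_abs; exact: measurable_sum.
  - have := L_sum r (fun nk => a nk.1)
      (fun nk => bounded_measurable_block_fun nk.1 [:: z nk.1 nk.2]).
    by apply: filterS => y /= ->.
have ur : uniq r.
  by apply: allpairs_uniq_dep => [|n _|[n k] [n' k'] _ _ [-> ->]//]; exact: iota_uniq.
rewrite measure_gt_abs_sum//; last first.
  move=> [n k] [n' k'] nk.
  apply: (measure_sub0 _ _ _ (disj n n' (pickle (n, k)) (pickle (n', k')) _)).
  - by apply: measurableI; exact: measurable_neq0.
  - by apply: measurableI; apply: measurable_neq0; exact: measurable_image.
  - by move=> y /=; rewrite !mulf_eq0 !negb_or => -[/andP[_ ?] /andP[_ ?]].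
  - by apply: contraNneq nk => /(pcan_inj pickleK) ->.
rewrite leNgt => /negP; apply.
(* Each block contributes at least [N n * delta / l n ^ p]. As [Y n >= 1], its integer part [N n] is
   at least [Y n / 2], which leaves [delta / 2 / rho ^ p]. *)
apply: (@lt_le_trans _ _ (\sum_(n <- iota 0 M) (delta / 2 / rho `^ p)%:E)%E).
  rewrite sumEFin lte_fin big_const_seq count_predT size_iota iter_addr_0.
  rewrite -[ltRHS]mulr_natl.
  have -> : M%:R * (delta / 2 / rho `^ p) = (M%:R * delta / 2) / rho `^ p by rewrite !mulrA.
  rewrite ltr_pM2r ?invr_gt0 ?powR_gt0// ltr_pdivlMr// -ltr_pdivrMr//.
  have -> : D * 12 * 2 / delta = 24 * D / delta by field; rewrite lt0r_neq0.
  exact: truncnS_gt.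
rewrite big_allpairs_dep big_seq [leRHS]big_seq; apply: lee_sum => n.
rewrite mem_iota add0n => /andP[_ nM]; have [l0 _] := lP n 0 nM.
apply: (@le_trans _ _ (\sum_(k <- iota 0 (N n)) (delta / l n `^ p)%:E)%E); last first.
  apply: lee_sum => k _; apply: le_trans (ltW (lP n (pickle (n, k)) nM).2) _.
  rewrite le_eqVlt; apply/orP; left; apply/eqP; congr (mu _).
  apply/seteqP; split=> y /=; rewrite /a nM normrM gtr0_norm ?divr_gt0//;
    by rewrite -mulrA ltr_pMr// mulrC ltr_pdivlMr// mul1r.
rewrite sumEFin lee_fin big_const_seq count_predT size_iota iter_addr_0.
rewrite -[leRHS]mulr_natl.
have -> : delta / 2 / rho `^ p = (Y n / 2) * (delta / l n `^ p).
  rewrite /Y powRM ?invr_ge0 ?(ltW l0) ?(ltW rho0)// powR_inv ?(ltW rho0)//.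
  by field; rewrite !lt0r_neq0 ?powR_gt0.
rewrite ler_pM2r ?(divr_gt0 delta0) ?powR_gt0//.
have N1 : 1 <= (N n)%:R :> R by rewrite ler1n /N truncn_gt0 Yge1.
have := truncnS_gt (Y n); rewrite -/(N n) -natr1 => ?.
by rewrite ler_pdivrMr//; lra.
Qed.

End embedding.

(** * Choice of the block coordinates and conclusion *)

Theorem theorem2 (R : realType) (p : R) (I : choiceType)
  (P : {measure set (cube I) -> \bar R})
  (d : measure_display) (Omega : measurableType d)
  (mu : {measure set Omega -> \bar R}) :
  1 < p ->
  ~ countable [set: I] ->
  coin_product P ->
  (exists A : set Omega, [/\ measurable A, (0 < mu A)%E & (mu A < +oo)%E]) ->
  purely_atomic mu ->
  ~ weakLp_embeds P mu p.
Proof.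
move=> p1 Iunc coinP _ pa emb; have p0 : 0 < p by exact: lt_trans p1.
have [L [D [D0 Lm Llin Lup Llow]]] := weakLp_embeds_tail p0 emb.
(* Excluding only the earlier terms themselves gives a sequence of distinct coordinates. *)
have [i _|J [_ JP]] := free_sequence (C := fun i => [set i]) Iunc.
  by rewrite setIT; exact: countable1.
have injJ : injective J.
  by move=> m n Jmn; case: (ltngtP m n) => // /JP[] /=; rewrite Jmn.
(* The index set is the union of the countable [range J] and the free coordinates, which are
   countable in both cases. *)
apply: Iunc; rewrite -(setvU (range J)).
have cntJ : countable (free_coords J).
  have [p2|p2] := leP p 2.
    exact: (no_embedding_le2 coinP p0 injJ D0 Lm Llin Lup Llow pa).
  exact: (no_embedding_gt2 coinP p0 injJ D0 Lm Llin Lup Llow pa).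
rewrite (_ : _ `|` _ = \bigcup_b (if b then free_coords J else range J)).
  apply: bigcup_countable => [|[] _//]; first exact: countableP.
  by apply: (sub_countable (card_image_le _ _)); exact: countableP.
by apply/seteqP; split=> [i [|]|i [[] _]]; [exists true|exists false|left|right].
Qed.
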